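(* Let $q$ be a prime power. For every $m,k\ge2$ there exists a minimal $[2k+m-2,k]_{q^m/q}$ code.
   Context: Let $q$ be a prime power and $n,m,k$ positive integers. For $v\in\mathbb{F}_{q^m}^n$ and an ordered basis $\Gamma=(\gamma_1,\dots,\gamma_m)$ of $\mathbb{F}_{q^m}$ over $\mathbb{F}_q$, let $\Gamma(v)\in\mathbb{F}_q^{n\times m}$ be the matrix with $v_i=\sum_{j}\Gamma(v)_{ij}\gamma_j$. The rank support $\sigma^{\mathrm{rk}}(v)\subseteq\mathbb{F}_q^n$ is the column space of $\Gamma(v)$ (independent of $\Gamma$). An $[n,k]_{q^m/q}$ code is a $k$-dimensional $\mathbb{F}_{q^m}$-subspace $\mathcal{C}\subseteq\mathbb{F}_{q^m}^n$; it is minimal if for all $v,v'\in\mathcal{C}$, $\sigma^{\mathrm{rk}}(v')\subseteq\sigma^{\mathrm{rk}}(v)$ implies $v'=\alpha v$ for some $\alpha\in\mathbb{F}_{q^m}$. *)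

(* Defs.v *)
From HB Require Import structures.
From mathcomp Require Import all_boot all_order all_algebra all_field.

Set Implicit Arguments.
Unset Strict Implicit.
Unset Printing Implicit Defensive.

Import GRing.Theory.
Local Open Scope ring_scope.

Section RankMetric.

Variables (F : fieldType) (L : fieldExtType F).

(* Meaningful only when Gamma is a basis of L over F: entry (i, j) is then the
   coordinate of v_i along gamma_j, see [expansion_mxP]. *)
Definition expansion_mx (m n : nat) (Gamma : m.-tuple L) (v : 'rV[L]_n) :
    'M[F]_(n, m) :=
  \matrix_(i < n, j < m) coord Gamma j (v 0 i).

Definition column_space (n m : nat) (A : 'M[F]_(n, m)) : {vspace 'cV[F]_n} :=
  <<[seq col j A | j : 'I_m]>>%VS.

(* The choice of basis is irrelevant, see [rank_supportE]. *)
Definition rank_support (n : nat) (v : 'rV[L]_n) : {vspace 'cV[F]_n} :=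
  column_space (expansion_mx (vbasis {:L}) v).

Definition minimal_code (n : nat) (C : {vspace 'rV[L]_n}) : Prop :=
  forall v v' : 'rV[L]_n, v \in C -> v' \in C ->
    (rank_support v' <= rank_support v)%VS ->
    exists alpha : L, v' = alpha *: v.

Lemma expansion_mxP (m n : nat) (Gamma : m.-tuple L) (v : 'rV[L]_n)
    (i : 'I_n) :
  basis_of {:L} Gamma ->
  v 0 i = \sum_(j < m) expansion_mx Gamma v i j *: Gamma`_j.
Proof.
move=> bG; rewrite [LHS](coord_basis bG (memvf _)).
by apply: eq_bigr => j _; rewrite mxE.
Qed.

Lemma column_space_sub (m1 m2 n : nat) (G1 : m1.-tuple L) (G2 : m2.-tuple L)
    (v : 'rV[L]_n) :
  basis_of {:L} G2 ->
  (column_space (expansion_mx G1 v) <= column_space (expansion_mx G2 v))%VS.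
Proof.
move=> bG; apply/span_subvP => _ /imageP[j _ ->].
have -> : col j (expansion_mx G1 v)
        = \sum_(l < m2) coord G1 j G2`_l *: col l (expansion_mx G2 v).
  apply/colP => i; rewrite !mxE (expansion_mxP v i bG) linear_sum summxE.
  by apply: eq_bigr => l _; rewrite linearZ !mxE mulrC.
apply: memv_suml => l _; apply/memvZ/memv_span.
by apply: image_f.
Qed.

Lemma rank_supportE (m n : nat) (Gamma : m.-tuple L) (v : 'rV[L]_n) :
  basis_of {:L} Gamma ->
  rank_support v = column_space (expansion_mx Gamma v).
Proof.
move=> bG; apply/eqP; rewrite eqEsubv.
by rewrite !column_space_sub // vbasisP.
Qed.

End RankMetric.

(* Main.v *)
(** Let Q = q^m and n = 2k + m - 2, and count pairs (G, (u, u')) where G is a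
    k x n matrix over the big field and u, u' are independent vectors such that
    the rank support of u'G lies in that of uG.  For fixed (u, u') the pair
    (uG, u'G) is uniformly distributed, and at most Q^m vectors have rank
    support inside a given one, so there are at most Q^(2k) Q^(kn + m - n) such
    pairs.  But each G with one bad pair (u, u') has all the (Q - 1)^2 Q bad
    pairs (l u, c u' + a u).  Since (Q - 1)^2 > Q, some G has no bad pair; it is
    then injective, because uG = 0 with u nonzero makes any (u', u) bad, and its
    row space is a minimal code. *)
Require Import Defs.
From HB Require Import structures.
From mathcomp Require Import all_boot all_order all_algebra all_field.
From mathcomp Require Import zify ring.

Set Implicit Arguments.
Unset Strict Implicit.
Unset Printing Implicit Defensive.

Import GRing.Theory.
Local Open Scope ring_scope.

Section RankSupport.

Variables (F : fieldType) (L : fieldExtType F) (n : nat).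
Implicit Types v w : 'rV[L]_n.

Lemma col_expansion_rank_support v j :
  col j (expansion_mx (vbasis {:L}) v) \in rank_support v.
Proof. exact/memv_span/image_f. Qed.

(** Multiplication by [a] is [F]-linear on [L], so each column of the expansion of [a *: v] is an
    [F]-combination of those of [v]. *)
Lemma rank_supportZ (a : L) v : (rank_support (a *: v) <= rank_support v)%VS.
Proof.
apply/span_subvP => _ /imageP[j _ ->].
have -> : col j (expansion_mx (vbasis {:L}) (a *: v)) =
    \sum_(l < \dim {:L}) coord (vbasis {:L}) j (a * (vbasis {:L})`_l) *:
      col l (expansion_mx (vbasis {:L}) v).
  apply/colP => i; rewrite !mxE {1}(expansion_mxP v i (vbasisP _)).
  rewrite mulr_sumr linear_sum summxE; apply: eq_bigr => l _.
  by rewrite -scalerAr linearZ !mxE /= mulrC.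
by apply: memv_suml => l _; apply: memvZ; apply: col_expansion_rank_support.
Qed.

Lemma rank_supportD v w :
  (rank_support (v + w) <= rank_support v + rank_support w)%VS.
Proof.
apply/span_subvP => _ /imageP[j _ ->].
have -> : col j (expansion_mx (vbasis {:L}) (v + w)) =
    col j (expansion_mx (vbasis {:L}) v) + col j (expansion_mx (vbasis {:L}) w).
  by apply/colP => i; rewrite !mxE linearD.
by apply: memv_add; apply: col_expansion_rank_support.
Qed.

Lemma rank_support_lin (l c a : L) v w : l != 0 ->
  (rank_support w <= rank_support v)%VS ->
  (rank_support (c *: w + a *: v) <= rank_support (l *: v))%VS.
Proof.
move=> l0 wv; have vl : (rank_support v <= rank_support (l *: v))%VS.
  by rewrite -{1}[v](scalerK l0) rank_supportZ.
apply: subv_trans vl; apply: subv_trans (rank_supportD _ _) _.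
by rewrite subv_add rank_supportZ (subv_trans (rank_supportZ _ _)).
Qed.

(** Since [w] is recovered from [y], this bounds by Q^m the number of vectors whose rank support
    lies in that of [v]. *)
Lemma rank_support_mulmx v w : (rank_support w <= rank_support v)%VS ->
  exists y : 'rV[L]_(\dim {:L}),
    w = y *m (map_mx (in_alg L) (expansion_mx (vbasis {:L}) v))^T.
Proof.
move=> wv.
pose X := [tuple col l (expansion_mx (vbasis {:L}) v) | l < \dim {:L}].
pose b j l : F := coord X l (col j (expansion_mx (vbasis {:L}) w)).
(* [b j l] is the coefficient of column [l] for [v] in column [j] for [w]; entry [l] of the witness
   gathers these along the basis of [L]. *)
exists (\row_(l < \dim {:L}) \sum_(j < \dim {:L}) b j l *: (vbasis {:L})`_j).
apply/rowP => i; rewrite (expansion_mxP w i (vbasisP _)) mxE.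
under [RHS]eq_bigr => l _ do rewrite !mxE mulr_suml.
rewrite exchange_big /=; apply: eq_bigr => j _.
have: col j (expansion_mx (vbasis {:L}) w) \in <<X>>%VS.
  exact: (subvP wv) (col_expansion_rank_support _ _).
move/coord_span/colP/(_ i); rewrite mxE => ->.
rewrite summxE scaler_suml; apply: eq_bigr => l _.
by rewrite -(tnth_nth 0 X) tnth_mktuple !mxE -/(b j l) mulr_algr scalerA mulrC.
Qed.

End RankSupport.

Lemma row_free_col_mx2 (K : fieldType) (k : nat) (u w : 'rV[K]_k) :
  u != 0 -> ~~ (w <= u)%MS -> row_free (col_mx u w).
Proof.
move=> u0 wu; rewrite /row_free eqn_leq rank_leq_row /=.
have : (u < u + w)%MS by rewrite ltmxE addsmxSl addsmx_sub submx_refl (negPf wu).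
rewrite ltmxErank => /andP[_].
by rewrite rank_rV u0 addsmxE.
Qed.

Section Counting.

Variables (K : finFieldType) (n m k : nat).
Variable R : rel 'rV[K]_n.

(** [R v w] stands for containment of the support of [w] in that of [v]; the count needs only a
    bound on its fibres and its stability under combinations. The first two conditions say that
    [u.1] and [u.2] are independent. *)
Definition bad_pair (G : 'M[K]_(k, n)) (u : 'rV[K]_k * 'rV[K]_k) :=
  [&& u.1 != 0, ~~ (u.2 <= u.1)%MS & R (u.1 *m G) (u.2 *m G)].

Hypothesis card_R : forall v, (#|[set w | R v w]| <= #|K| ^ m)%N.
Hypothesis R_lin : forall (l c a : K) v w,
  l != 0 -> R v w -> R (l *: v) (c *: w + a *: v).

(** Division-free form of a probability bound: for independent u, w the pair (uG, wG) is uniform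
    among Q^(2n) pairs, at most Q^(n+m) of which satisfy [R]. *)
Lemma card_bad_matrices u :
  (#|[set G | bad_pair G u]| * #|K| ^ (2 * n) <= #|K| ^ (n + m) * #|K| ^ (k * n))%N.
Proof.
case: u => u w.
have [/andP[u0 wu]|nuw] := boolP ((u != 0) && ~~ (w <= u)%MS); last first.
  rewrite (_ : [set _ | _] = set0) ?cards0 //; apply/setP => G.
  by rewrite !inE /bad_pair /= andbA (negPf nuw).
have /row_freeP[V UV] := row_free_col_mx2 u0 wu.
pose U := col_mx u w.
(* Left multiplication by V is a section of G |-> U *m G; hence all fibres of
   the latter have the same size, and f encodes the resulting inequality. *)
pose f (x : 'M[K]_(k, n) * 'M[K]_(1 + 1, n)) := (U *m x.1, x.1 + V *m x.2).
have f_inj : injective f.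
  move=> [G W] [G' W'] [eU eV].
  have : U *m (G + V *m W) = U *m (G' + V *m W') by rewrite eV.
  rewrite !mulmxDr !mulmxA UV !mul1mx eU => /addrI eW.
  by move: eV; rewrite eW => /addIr ->.
pose P := [set W : 'M[K]_(1 + 1, n) | R (usubmx W) (dsubmx W)].
have card_P : (#|P| <= #|K| ^ (n + m))%N.
  pose g (W : 'M[K]_(1 + 1, n)) := (usubmx W, dsubmx W).
  have g_inj : injective g.
    by move=> W W' [eu ed]; rewrite -[W]vsubmxK -[W']vsubmxK eu ed.
  rewrite -(card_imset _ g_inj).
  apply: (@leq_trans #|[set x : 'rV[K]_n * 'rV[K]_n | R x.1 x.2]|).
    by apply/subset_leq_card/subsetP => _ /imsetP[W + ->]; rewrite !inE.
  (* There are Q^n choices of the first row, then at most Q^m of the second. *)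
  rewrite -sum1_card (partition_big fst predT) //=.
  apply: (@leq_trans (\sum_(v : 'rV[K]_n) #|K| ^ m)); last first.
    by rewrite sum_nat_const card_mx mul1n expnD.
  apply: leq_sum => v _; rewrite sum1dep_card; apply: leq_trans (card_R v).
  rewrite -(card_in_imset (f := snd)).
    apply/subset_leq_card/subsetP => _ /imsetP[[a b] + ->]; rewrite !inE /=.
    by case/andP=> Rab /eqP<-.
  move=> [a b] [a' b']; rewrite !inE /= => /andP[_ /eqP->] /andP[_ /eqP->].
  by move->.
apply: (@leq_trans #|setX P [set: 'M[K]_(k, n)]|); last first.
  by rewrite cardsX cardsT card_mx leq_mul2r card_P orbT.
rewrite -[(2 * n)%N]/((1 + 1) * n)%N -(card_mx K (1 + 1) n).
rewrite -[#|{:'M[K]_(1 + 1, n)}|]cardsT -cardsX -(card_imset _ f_inj).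
apply/subset_leq_card/subsetP => _ /imsetP[[G W] + ->].
by rewrite !inE /= /U mul_col_mx col_mxKu col_mxKd !andbT => /and3P[].
Qed.

(** Independence lets [l], [c] and [a] be read off from the pair (l u, c w + a u); nonzero [l] and
    [c] keep that pair independent. *)
Lemma card_bad_pairs G u : bad_pair G u ->
  (#|K|.-1 ^ 2 * #|K| <= #|[set u | bad_pair G u]|)%N.
Proof.
case: u => u w /and3P[/= u0 wu Ruw].
pose f (x : K * K * K) := (x.1.1 *: u, x.1.2 *: w + x.2 *: u).
have scaleuI (a b : K) : a *: u = b *: u -> a = b.
  move/eqP; rewrite -subr_eq0 -scalerBl scaler_eq0 (negPf u0) orbF subr_eq0.
  by move/eqP.
have f_inj : injective f.
  move=> [[l c] a] [[l' c'] a'] [/scaleuI -> /= e].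
  have ec : c = c'.
    apply/eqP; rewrite -subr_eq0; apply: contraNT wu => c0.
    apply/sub_rVP; exists ((c - c')^-1 * (a' - a)).
    rewrite -scalerA -[w in LHS](scalerK c0); congr (_ *: _).
    rewrite !scalerBl; apply/(addIr (c' *: w + a *: u)).
    by rewrite addrA subrK e addrA addrAC subrK addrC.
  by move: e; rewrite ec => /addrI /scaleuI ->.
have card0 : #|[set x : K | x != 0]| = #|K|.-1.
  by rewrite -(cardC1 (0 : K)); apply: eq_card => x; rewrite !inE.
apply: (@leq_trans #|setX (setX [set x : K | x != 0] [set x : K | x != 0]) [set: K]|).
  by rewrite !cardsX cardsT card0 expnS expn1.
rewrite -(card_imset _ f_inj).
apply/subset_leq_card/subsetP => _ /imsetP[[[l c] a] + ->]; rewrite !inE /=.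
rewrite andbT => /andP[l0 c0]; rewrite /bad_pair /=.
rewrite scaler_eq0 negb_or l0 u0 /=; apply/andP; split; last first.
  by rewrite mulmxDl -!scalemxAl R_lin.
rewrite (eqmx_scale _ l0); apply: contra wu => wu.
rewrite -[w](scalerK c0) scalemx_sub // -(addrK (a *: u) (c *: w)).
by rewrite addmx_sub // -scaleNr scalemx_sub.
Qed.

Lemma ex_matrix_without_bad_pair :
  (2 < #|K|)%N -> (2 * k + m <= n + 2)%N ->
  exists G : 'M[K]_(k, n), forall u, ~~ bad_pair G u.
Proof.
move=> Q2 hn; set Q := #|K| in Q2.
suff /existsP[G /forallP GP] : [exists G : 'M[K]_(k, n), [forall u, ~~ bad_pair G u]].
  by exists G.
apply: contraT; rewrite negb_exists => /forallP noG.
have lower : (Q ^ (k * n) * (Q.-1 ^ 2 * Q) <=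
    \sum_(G : 'M[K]_(k, n)) #|[set u | bad_pair G u]|)%N.
  rewrite -(card_mx K k n) -sum_nat_const; apply: leq_sum => G _.
  by have := noG G; rewrite negb_forall => /existsP[u /negPn]; apply: card_bad_pairs.
have swap : \sum_(G : 'M[K]_(k, n)) #|[set u | bad_pair G u]| =
    \sum_u #|[set G | bad_pair G u]|.
  under eq_bigr => G _ do rewrite -sum1dep_card big_mkcond.
  rewrite exchange_big /=; apply: eq_bigr => u _.
  by rewrite -sum1dep_card [RHS]big_mkcond.
have upper : ((\sum_u #|[set G | bad_pair G u]|) * Q ^ (2 * n) <=
    Q ^ (2 * k) * (Q ^ (n + m) * Q ^ (k * n)))%N.
  rewrite big_distrl /=.
  apply: leq_trans (leq_sum _ (fun u _ => card_bad_matrices u)) _.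
  by rewrite sum_nat_const card_prod !card_mx !mul1n -expnD addnn -mul2n.
have Q0 : (0 < Q)%N by apply: leq_trans Q2.
have : (Q ^ (k * n) * (Q.-1 ^ 2 * Q) * Q ^ (2 * n) <=
    Q ^ (2 * k) * (Q ^ (n + m) * Q ^ (k * n)))%N.
  by apply: leq_trans upper; rewrite leq_mul2r -swap lower orbT.
have -> : (Q ^ (k * n) * (Q.-1 ^ 2 * Q) * Q ^ (2 * n) =
    Q ^ (k * n + n) * (Q.-1 ^ 2 * Q ^ n.+1))%N.
  by rewrite mul2n -addnn !expnD (expnS Q n); ring.
have -> : (Q ^ (2 * k) * (Q ^ (n + m) * Q ^ (k * n)) =
    Q ^ (k * n + n) * Q ^ (2 * k + m))%N.
  by rewrite !expnD; ring.
rewrite leq_pmul2l ?expn_gt0 ?Q0 // => le1.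
have /(leq_trans le1) : (Q ^ (2 * k + m) <= Q ^ (n + 2))%N by rewrite leq_pexp2l.
(* Cancelling Q^(n+1) leaves (Q - 1)^2 <= Q, which fails once Q >= 3. *)
rewrite addn2 expnS leq_pmul2r ?expn_gt0 ?Q0 //; nia.
Qed.

End Counting.

(** A row has rank at most 1, while the identity has rank [k]. *)
Lemma exists_nsubmx_rV (K : fieldType) (k : nat) (u : 'rV[K]_k) :
  (2 <= k)%N -> exists w : 'rV[K]_k, ~~ (w <= u)%MS.
Proof.
move=> hk; suff : ~~ (1%:M <= u)%MS by move/row_subPn => [i]; exists (row i 1%:M).
apply/negP => /mxrankS; rewrite mxrank1 => /leq_trans/(_ (rank_leq_row _)).
by rewrite leqNgt hk.
Qed.

Lemma card_finvect (F : finFieldType) (L : fieldExtType F) :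
  #|{: finvect_type L}| = (#|F| ^ \dim {:L})%N.
Proof.
by rewrite -(card_vspacef (Vector.class (finvect_type L : vectType F))) card_vspace.
Qed.

Lemma ex_matrix_rank_support (F : finFieldType) (L : fieldExtType F) (n k : nat) :
  (2 <= \dim {:L})%N -> (2 * k + \dim {:L} <= n + 2)%N ->
  exists G : 'M[L]_(k, n), forall u w : 'rV[L]_k, u != 0 -> ~~ (w <= u)%MS ->
    ~~ (rank_support (w *m G) <= rank_support (u *m G))%VS.
Proof.
move=> hm hn.
(* K is L itself, with its finite type structure. *)
pose K : finFieldType := finvect_type L.
pose R : rel 'rV[K]_n := fun v w : 'rV[L]_n => (rank_support w <= rank_support v)%VS.
have [] := @ex_matrix_without_bad_pair K n (\dim {:L}) k R.
- move=> v; pose M := (map_mx (in_alg L) (expansion_mx (vbasis {:L}) v))^T.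
  have <- : #|'rV[K]_(\dim {:L})| = (#|K| ^ \dim {:L})%N by rewrite card_mx mul1n.
  apply: leq_trans (leq_imset_card (mulmxr (M : 'M[K]_(_, n))) predT).
  apply/subset_leq_card/subsetP => w; rewrite inE => /rank_support_mulmx[y wE].
  by apply/imsetP; exists y.
- by move=> l c a v w l0; apply: rank_support_lin.
(* Here [2 <= \dim {:L}] enters: d < |F|^d yields |K| > 2. *)
- have -> : #|K| = (#|F| ^ \dim {:L})%N by apply: card_finvect.
  move: (\dim {:L}) hm => d hm.
  exact: leq_ltn_trans hm (ltn_expl d (finNzRing_gt1 F)).
- exact: hn.
move=> G GP; exists G => u w u0 wu.
by have := GP (u, w); rewrite /bad_pair /= u0 wu.
Qed.

Theorem corollary6p11 (p e : nat) (hp : prime p) (he : (0 < e)%N)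
    (F : finFieldType) (hF : #|F| = (p ^ e)%N)
    (m k : nat) (hm : (2 <= m)%N) (hk : (2 <= k)%N)
    (L : fieldExtType F) (hL : \dim {:L} = m) :
  exists C : {vspace 'rV[L]_(2 * k + m - 2)},
    \dim C = k /\ minimal_code C.
Proof.
have [G GP] : exists G : 'M[L]_(k, 2 * k + m - 2), forall u w : 'rV[L]_k,
    u != 0 -> ~~ (w <= u)%MS ->
    ~~ (rank_support (w *m G) <= rank_support (u *m G))%VS.
  by apply: ex_matrix_rank_support; rewrite hL // subnK // ltn_addl.
(* If [w] were nonzero, any [u] off its line would make (u, w) bad, as the support of 0 lies in
   every support. Injectivity of [G] follows. *)
have zeroP (w : 'rV[L]_k) :
    (rank_support (w *m G) <= rank_support (0 : 'rV[L]_(2 * k + m - 2)))%VS -> w = 0.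
  move=> w0; apply/eqP; apply: contraT => wn0.
  have [u uw] := exists_nsubmx_rV w hk.
  have u0 : u != 0 by apply: contraNneq uw => ->; rewrite sub0mx.
  have wu : ~~ (w <= u)%MS.
    apply: contra uw => /sub_rVP[a wE]; have a0 : a != 0.
      by apply: contraNneq wn0 => a0; rewrite wE a0 scale0r.
    by rewrite wE (eqmx_scale _ a0).
  case/negP: (GP u w u0 wu); apply: subv_trans w0 _.
  by rewrite -(scale0r (u *m G)) rank_supportZ.
pose f := linfun (mulmxr G : 'rV[L]_k -> 'rV[L]_(2 * k + m - 2)).
have fE u : f u = u *m G by rewrite lfunE.
exists (limg f); split.
  rewrite limg_dim_eq ?dimvf ?[dim _]mul1n //.
  apply/eqP; rewrite capfv -subv0; apply/subvP => u; rewrite memv_ker fE memv0.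
  by move=> /eqP uG; apply/eqP/zeroP; rewrite uG.
move=> _ _ /memv_imgP[u _ ->] /memv_imgP[w _ ->]; rewrite !fE => wu.
(* [GP] says nothing about u = 0; [zeroP] covers that case. *)
have [u0|u0] := eqVneq u 0.
  exists 1; rewrite scale1r u0 (zeroP w) //.
  by move: wu; rewrite u0 mul0mx.
have [/sub_rVP[a ->]|nwu] := boolP (w <= u)%MS.
  by exists a; rewrite scalemxAl.
by case/negP: (GP u w u0 nwu).
Qed.
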